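(* Let $n>2$ be odd, let $w\in\mathbb{C}$ be a primitive $n$th root of unity, and let $(l,k)$ be integers labelling a two-dimensional irreducible representation $\pi_2^{(l,k)}$ of $D(D_n)$, i.e. either $l=0$ and $1\le k\le\frac{n-1}{2}$, or $1\le l\le \frac{n-1}{2}$ and $0\le k\le n-1$. Let $$r(z)=\begin{pmatrix} w^{2kl}z^{-1}-w^{-2kl}z&0&0&0\\0&z^{-1}-z&w^{2kl}-w^{-2kl}&0\\0&w^{2kl}-w^{-2kl}&z^{-1}-z&0\\0&0&0&w^{2kl}z^{-1}-w^{-2kl}z\end{pmatrix}\in \mathrm{End}(\mathbb{C}^2\otimes\mathbb{C}^2)$$ and $$L(z)=\sum_{i=0}^{n-1}\Big\{(w^{2ik}e_{1,2}+w^{-2ik}e_{2,1})\otimes e_{i,i}+z\,[\,e_{1,1}\otimes e_{i-l,i}+e_{2,2}\otimes e_{i+l,i}\,]\Big\}\in\mathrm{End}(\mathbb{C}^2\otimes\mathbb{C}^n).$$ Then, on $\mathbb{C}^2\otimes\mathbb{C}^2\otimes\mathbb{C}^n$, $$r_{12}(xy^{-1})L_{13}(x)L_{23}(y)=L_{23}(y)L_{13}(x)r_{12}(xy^{-1})$$ for all $x,y\in\mathbb{C}$ for which both sides are defined (i.e. $x,y\neq0$).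
   Context: In the second tensor factor $\mathbb{C}^n$ of $L(z)$, $e_{i,j}$ denotes the $n\times n$ elementary matrix with indices taken modulo $n$ (so $e_{i,j}e_{p,q}=e_{i,q}$ if $j\equiv p \pmod n$ and $0$ otherwise; $e_{0,0}$ is the matrix with entry in the $n$th row and $n$th column). In the first factor $\mathbb{C}^2$, $e_{1,1},e_{1,2},e_{2,1},e_{2,2}$ are the usual $2\times2$ elementary matrices. The matrix $r(z)$ is written in the ordered basis $v_1\otimes v_1,\ v_1\otimes v_2,\ v_2\otimes v_1,\ v_2\otimes v_2$ of $\mathbb{C}^2\otimes\mathbb{C}^2$. Subscripts indicate the tensor factors on which an operator acts (it acts as the identity on the remaining factor). *)

(* Defs.v *)
From mathcomp Require Import all_boot all_order all_algebra.
From mathcomp Require Import reals complex mxtens.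

Set Implicit Arguments.
Unset Strict Implicit.
Unset Printing Implicit Defensive.

Import GRing.Theory.
Local Open Scope ring_scope.

(* Throughout, End(V1 (x) V2) is represented by 'M_(d1 * d2) and
   End(V1 (x) V2 (x) V3) by 'M_(d1 * d2 * d3), using mxtens' lexicographic
   ordering of the tensor basis. *)

(* Row a : 'I_n (0-based) stands for the basis vector numbered a.+1, so that
   emod n 0 0 has its nonzero entry in the last row and column. *)
Definition emod (F : fieldType) (n : nat) (i j : int) : 'M[F]_n :=
  \matrix_(a < n, b < n)
    ((a.+1%:Z == i %[mod n%:Z])%Z && (b.+1%:Z == j %[mod n%:Z])%Z)%:R.

Definition rmat (F : fieldType) (w : F) (l k : int) (z : F) : 'M[F]_(2 * 2) :=
  let a := w ^ (2 * k * l) * z^-1 - w ^ (- (2 * k * l)) * z in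
  let b := z^-1 - z in
  let c := w ^ (2 * k * l) - w ^ (- (2 * k * l)) in
  let rows := [:: [:: a; 0; 0; 0];
                  [:: 0; b; c; 0];
                  [:: 0; c; b; 0];
                  [:: 0; 0; 0; a]] in
  \matrix_(i, j) nth 0 (nth [::] rows i) j.

Definition Lmat (F : fieldType) (n : nat) (w : F) (l k : int) (z : F)
    : 'M[F]_(2 * n) :=
  let e11 : 'M[F]_2 := delta_mx 0 0 in
  let e12 : 'M[F]_2 := delta_mx 0 1 in
  let e21 : 'M[F]_2 := delta_mx 1 0 in
  let e22 : 'M[F]_2 := delta_mx 1 1 in
  \sum_(i < n)
    ((w ^ (2 * i%:Z * k) *: e12 + w ^ (- (2 * i%:Z * k)) *: e21)
        *t emod F n i%:Z i%:Z
     + z *: (e11 *t emod F n (i%:Z - l) i%:Z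
             + e22 *t emod F n (i%:Z + l) i%:Z)).

Section TensorLegs.
Variables (F : fieldType) (d1 d2 d3 : nat).

Definition leg1 (s : 'I_(d1 * d2 * d3)) : 'I_d1 :=
  (mxtens_unindex (mxtens_unindex s).1).1.
Definition leg2 (s : 'I_(d1 * d2 * d3)) : 'I_d2 :=
  (mxtens_unindex (mxtens_unindex s).1).2.
Definition leg3 (s : 'I_(d1 * d2 * d3)) : 'I_d3 := (mxtens_unindex s).2.

Definition op12 (A : 'M[F]_(d1 * d2)) : 'M[F]_(d1 * d2 * d3) :=
  \matrix_(s, t) (A (mxtens_index (leg1 s, leg2 s))
                    (mxtens_index (leg1 t, leg2 t)) * (leg3 s == leg3 t)%:R).

Definition op13 (A : 'M[F]_(d1 * d3)) : 'M[F]_(d1 * d2 * d3) :=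
  \matrix_(s, t) (A (mxtens_index (leg1 s, leg3 s))
                    (mxtens_index (leg1 t, leg3 t)) * (leg2 s == leg2 t)%:R).

Definition op23 (A : 'M[F]_(d2 * d3)) : 'M[F]_(d1 * d2 * d3) :=
  \matrix_(s, t) (A (mxtens_index (leg2 s, leg3 s))
                    (mxtens_index (leg2 t, leg3 t)) * (leg1 s == leg1 t)%:R).

Lemma op12_tens (X : 'M[F]_d1) (Y : 'M[F]_d2) : op12 (X *t Y) = X *t Y *t 1%:M.
Proof. by apply/matrixP=> s t; rewrite !mxE !mxtens_indexK. Qed.

Lemma op13_tens (X : 'M[F]_d1) (Y : 'M[F]_d3) : op13 (X *t Y) = X *t 1%:M *t Y.
Proof. by apply/matrixP=> s t; rewrite !mxE !mxtens_indexK /= mulrAC. Qed.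

Lemma op23_tens (X : 'M[F]_d2) (Y : 'M[F]_d3) : op23 (X *t Y) = 1%:M *t X *t Y.
Proof.
by apply/matrixP=> s t; rewrite !mxE !mxtens_indexK /= -mulrA mulrC mulrA.
Qed.

End TensorLegs.

(* Main.v *)
Require Import Defs.
From mathcomp Require Import all_boot all_order all_algebra.
From mathcomp Require Import reals complex mxtens.
From mathcomp Require Import ring.

Import GRing.Theory.
Local Open Scope ring_scope.

(** The operator [L(z)] is a two by two matrix whose entries are operators on
    the last tensor factor:
    <<
       L(z) = ( z S     D   )        S = shift_mx l,   D = clock_mx (2 * k),
              ( D^-1  z S^-1 )
    >>
    where [S] permutes the basis cyclically by [l] steps and [D] is diagonal
    with entries the successive powers of [w ^ (2 * k)].  These two operators
    form a Weyl pair: [S D = q D S] with [q = w ^ (2 * k * l)]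
    ([shift_mx_clock_mx]); since [w ^ n = 1], both the diagonal entries of [D]
    and the shift depend on indices only modulo [n], so the relation survives
    the wrap-around.

    Written out on the basis of the first two factors, the identity to prove
    is a family of sixteen equations in the algebra of operators on the last
    factor ([exchange_of_blocks]).  The six-vertex shape of [r] leaves at most
    two terms on each side, and the Weyl relation brings every product to a
    multiple of one and the same operator.  What remains is scalar.  For
    instance the equation at row [v1 v1] and column [v1 v2] reads
    <<
       (q y/x - q^-1 x/y) x S D = (y/x - x/y) x D S + (q - q^-1) y S D,
    >>
    which after substituting [D S = q^-1 S D] is a rational identity in
    [q], [x], [y]. *)

(** * Tensor products as block matrices *)

Lemma ord2_ind (P : 'I_2 -> Prop) : P 0 -> P 1 -> forall a, P a.
Proof.
move=> P0 P1 [[|[|//]] lt_a2].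
  by have <- : 0 = Ordinal lt_a2 by apply: val_inj.
by have <- : 1 = Ordinal lt_a2 by apply: val_inj.
Qed.

Lemma sum_ord2 (V : nmodType) (f : 'I_2 -> V) : \sum_e f e = f 0 + f 1.
Proof.
by rewrite big_ord_recl big_ord1; congr (_ + f _); apply: val_inj.
Qed.

Lemma sum_mxtens_index (V : nmodType) (d d' : nat) (f : 'I_(d * d') -> V) :
  \sum_s f s = \sum_e \sum_g f (mxtens_index (e, g)).
Proof.
rewrite pair_bigA /= (reindex (@mxtens_index d d')) /=.
  by apply: eq_bigr=> -[].
by exists (@mxtens_unindex d d')=> ? _;
  [exact: mxtens_indexK | exact: mxtens_unindexK].
Qed.

Section Blocks.
Variables (F : fieldType) (d d' : nat).
Implicit Types A B : 'M[F]_(d * d').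

Definition block A (a c : 'I_d) : 'M[F]_d' :=
  \matrix_(i, j) A (mxtens_index (a, i)) (mxtens_index (c, j)).

Lemma blockD A B a c : block (A + B) a c = block A a c + block B a c.
Proof. by apply/matrixP=> i j; rewrite !mxE. Qed.

Lemma blockZ u A a c : block (u *: A) a c = u *: block A a c.
Proof. by apply/matrixP=> i j; rewrite !mxE. Qed.

Lemma block_sum n (A_ : 'I_n -> 'M[F]_(d * d')) a c :
  block (\sum_i A_ i) a c = \sum_i block (A_ i) a c.
Proof.
by apply/matrixP=> i j; rewrite !mxE !summxE; apply: eq_bigr=> s _; rewrite !mxE.
Qed.

Lemma block_tens (X : 'M[F]_d) (Y : 'M[F]_d') a c :
  block (X *t Y) a c = X a c *: Y.
Proof. by apply/matrixP=> i j; rewrite !mxE !mxtens_indexK. Qed.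

Lemma block_mul A B a c :
  block (A *m B) a c = \sum_e block A a e *m block B e c.
Proof.
apply/matrixP=> i j; rewrite !mxE summxE sum_mxtens_index.
apply: eq_bigr=> e _; rewrite mxE.
by apply: eq_bigr=> s _; rewrite !mxE.
Qed.

Lemma eq_block A B : (forall a c, block A a c = block B a c) -> A = B.
Proof.
move=> eqAB; apply/matrixP=> s t.
rewrite -(mxtens_unindexK s) -(mxtens_unindexK t).
case: (mxtens_unindex s) (mxtens_unindex t) => a i [c j].
by move/matrixP/(_ i j): (eqAB a c); rewrite !mxE.
Qed.

End Blocks.
Arguments block {F d d'}.
Arguments eq_block {F d d'}.

Section TripleProduct.
Variables (F : fieldType) (d1 d2 d3 : nat).
Variables (r : 'M[F]_(d1 * d2)) (A : 'M[F]_(d1 * d3)) (B : 'M[F]_(d2 * d3)).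

Lemma block_op12 a b c d :
  block (op12 d3 r) (mxtens_index (a, b)) (mxtens_index (c, d))
  = (r (mxtens_index (a, b)) (mxtens_index (c, d)))%:M.
Proof.
apply/matrixP=> i j; rewrite !mxE /leg1 /leg2 /leg3 !mxtens_indexK /=.
by rewrite mulr_natr.
Qed.

Lemma block_op13 a b c d :
  block (op13 d2 A) (mxtens_index (a, b)) (mxtens_index (c, d))
  = (b == d)%:R *: block A a c.
Proof.
apply/matrixP=> i j; rewrite !mxE /leg1 /leg2 /leg3 !mxtens_indexK /=.
by rewrite mulrC.
Qed.

Lemma block_op23 a b c d :
  block (op23 d1 B) (mxtens_index (a, b)) (mxtens_index (c, d))
  = (a == c)%:R *: block B b d.
Proof.
apply/matrixP=> i j; rewrite !mxE /leg1 /leg2 /leg3 !mxtens_indexK /=.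
by rewrite mulrC.
Qed.

Lemma block_op13_op23 a b c d :
  block (op13 d2 A *m op23 d1 B) (mxtens_index (a, b)) (mxtens_index (c, d))
  = block A a c *m block B b d.
Proof.
rewrite block_mul sum_mxtens_index (bigD1 c) //= [X in _ + X]big1 ?addr0.
  rewrite (bigD1 b) //= big1 ?addr0 => [|g].
    by rewrite block_op13 block_op23 !eqxx !scale1r.
  by rewrite eq_sym => /negPf neq_bg; rewrite block_op13 neq_bg scale0r mul0mx.
move=> e /negPf neq_ec; rewrite big1 // => g _.
by rewrite block_op23 neq_ec scale0r mulmx0.
Qed.

Lemma block_op23_op13 a b c d :
  block (op23 d1 B *m op13 d2 A) (mxtens_index (a, b)) (mxtens_index (c, d))
  = block B b d *m block A a c.
Proof.
rewrite block_mul sum_mxtens_index (bigD1 a) //= [X in _ + X]big1 ?addr0.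
  rewrite (bigD1 d) //= big1 ?addr0 => [|g].
    by rewrite block_op13 block_op23 !eqxx !scale1r.
  by move=> /negPf neq_gd; rewrite block_op13 neq_gd scale0r mulmx0.
move=> e; rewrite eq_sym => /negPf neq_ae; rewrite big1 // => g _.
by rewrite block_op23 neq_ae scale0r mul0mx.
Qed.

(** The passage from operators on three factors to operators on the last one
    only: [r] acts there by scalars, so the order of factors matters only for
    the blocks of [A] and [B]. *)
Lemma exchange_of_blocks :
  (forall a b c d,
     \sum_e \sum_g r (mxtens_index (a, b)) (mxtens_index (e, g))
                     *: (block A e c *m block B g d)
   = \sum_e \sum_g r (mxtens_index (e, g)) (mxtens_index (c, d))
                     *: (block B b g *m block A a e)) ->
  op12 d3 r *m op13 d2 A *m op23 d1 B = op23 d1 B *m op13 d2 A *m op12 d3 r.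
Proof.
move=> exchange; rewrite -mulmxA; apply: eq_block=> s t.
rewrite -(mxtens_unindexK s) -(mxtens_unindexK t).
case: (mxtens_unindex s) (mxtens_unindex t) => a b [c d].
rewrite !block_mul !sum_mxtens_index.
under eq_bigr => e _ do under eq_bigr => g _ do
  rewrite block_op12 mul_scalar_mx block_op13_op23.
rewrite exchange; apply: eq_bigr=> e _; apply: eq_bigr=> g _.
by rewrite block_op12 mul_mx_scalar block_op23_op13.
Qed.

End TripleProduct.

(** * The Weyl pair *)

Section Weyl.
Variables (F : fieldType) (n : nat) (w : F).
Hypotheses (n_gt0 : (0 < n)%N) (wn1 : w ^+ n = 1).

Definition shift_mx (m : int) : 'M[F]_n :=
  \matrix_(a, b) (a%:Z + m == b%:Z %[mod n%:Z])%Z%:R.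

(** The exponent uses [a.+1] because row [a] stands for the basis vector
    numbered [a.+1]. *)
Definition clock_mx (p : int) : 'M[F]_n :=
  \matrix_(a, b) (w ^ (a.+1%:Z * p) *+ (a == b)).

(** The naturals below [n] represent each residue class exactly once, which
    turns every sum over the cyclic index set into the evaluation of a periodic
    function. *)
Lemma sum_residue (f : int -> F) (c : int) :
  (forall i j : int, (i = j %[mod n%:Z])%Z -> f i = f j) ->
  \sum_(i < n) (c == i%:Z %[mod n%:Z])%Z%:R * f i%:Z = f c.
Proof.
move=> f_periodic; have n_neq0 : n%:Z != 0 by rewrite -lt0n.
have lt_cn : (`|(c %% n%:Z)%Z| < n)%N.
  by rewrite -ltz_nat gez0_abs ?modz_ge0 // ltz_pmod.
rewrite (bigD1 (Ordinal lt_cn)) //= gez0_abs ?modz_ge0 // modz_mod eqxx mul1r.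
rewrite big1 ?addr0 => [|i]; first by apply: f_periodic; rewrite modz_mod.
move=> neq_ic; case: eqP => [eq_ci|]; last by rewrite mul0r.
case/eqP: neq_ic; apply: val_inj=> /=; rewrite eq_ci.
by rewrite modz_small //= ltz_nat ltn_ord.
Qed.

Lemma unity_root_neq0 : w != 0.
Proof.
apply/eqP=> w0; move: wn1; rewrite w0 expr0n gtn_eqF // => /esym/eqP.
by rewrite oner_eq0.
Qed.

Lemma expz_modz (i j : int) : (i = j %[mod n%:Z])%Z -> w ^ i = w ^ j.
Proof.
have reduce (e : int) : w ^ e = w ^ (e %% n%:Z)%Z.
  rewrite {1}(divz_eq e n%:Z) expfzDr ?unity_root_neq0 //.
  by rewrite [(_ * n%:Z)%R]mulrC -exprz_exp -exprnP wn1 exp1rz mul1r.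
by move=> eq_ij; rewrite reduce eq_ij -reduce.
Qed.

Lemma eqz_mod_ord (a b : 'I_n) : (a%:Z == b%:Z %[mod n%:Z])%Z = (a == b).
Proof. by rewrite !modz_nat !modn_small. Qed.

Lemma eqz_modMr (i j p : int) :
  (i = j %[mod n%:Z])%Z -> (i * p = j * p %[mod n%:Z])%Z.
Proof. by move=> eq_ij; rewrite -modzMml eq_ij modzMml. Qed.

Lemma shift_mx0 : shift_mx 0 = 1%:M.
Proof. by apply/matrixP=> a b; rewrite !mxE addr0 eqz_mod_ord. Qed.

Lemma clock_mx0 : clock_mx 0 = 1%:M.
Proof. by apply/matrixP=> a b; rewrite !mxE mulr0. Qed.

Lemma shift_mxD m m' : shift_mx m *m shift_mx m' = shift_mx (m + m').
Proof.
apply/matrixP=> a b; rewrite !mxE.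
under eq_bigr => i _ do rewrite !mxE.
rewrite (sum_residue (fun i => (i + m' == b%:Z %[mod n%:Z])%Z%:R)) ?addrA //.
by move=> i j eq_ij; rewrite -modzDml eq_ij modzDml.
Qed.

Lemma clock_mx_mulE p (M : 'M_n) a b :
  (clock_mx p *m M) a b = w ^ (a.+1%:Z * p) * M a b.
Proof.
rewrite mxE (bigD1 a) //= big1 ?addr0 ?mxE ?eqxx //.
by move=> i; rewrite eq_sym=> /negPf neq_ai; rewrite mxE neq_ai mul0r.
Qed.

Lemma mul_clock_mxE p (M : 'M_n) a b :
  (M *m clock_mx p) a b = M a b * w ^ (b.+1%:Z * p).
Proof.
rewrite mxE (bigD1 b) //= big1 ?addr0 ?mxE ?eqxx //.
by move=> i /negPf neq_ib; rewrite mxE neq_ib mulr0.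
Qed.

Lemma clock_mxD p p' : clock_mx p *m clock_mx p' = clock_mx (p + p').
Proof.
apply/matrixP=> a b; rewrite clock_mx_mulE !mxE mulrDr.
by rewrite expfzDr ?unity_root_neq0 // mulrnAr.
Qed.

(** At a nonzero entry of the shift the column index exceeds the row index by
    [m] modulo [n], hence the two diagonal weights differ by the constant
    [w ^ (m * p)]. *)
Lemma shift_mx_clock_mx m p :
  shift_mx m *m clock_mx p = w ^ (m * p) *: (clock_mx p *m shift_mx m).
Proof.
apply/matrixP=> a b; rewrite mul_clock_mxE [RHS]mxE clock_mx_mulE !mxE.
case: eqP => [eq_ab|]; last by rewrite mul0r !mulr0.
rewrite mul1r mulr1 -expfzDr ?unity_root_neq0 //; apply: expz_modz.
rewrite -mulrDl; apply: eqz_modMr.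
by rewrite !intS addrCA [m + _]addrC -[RHS]modzDmr eq_ab modzDmr.
Qed.

Lemma sum_emod_shift m :
  \sum_(i < n) emod F n (i%:Z - m) i%:Z = shift_mx m.
Proof.
apply/matrixP=> a b; rewrite summxE mxE.
transitivity (\sum_(i < n) (b.+1%:Z == i%:Z %[mod n%:Z])%Z%:R
    * (a.+1%:Z == i%:Z - m %[mod n%:Z])%Z%:R : F).
  by apply: eq_bigr=> i _; rewrite !mxE -mulnb natrM mulrC.
rewrite (sum_residue (fun i => (a.+1%:Z == i - m %[mod n%:Z])%Z%:R)).
  by rewrite !eqz_mod_dvd; congr (_ %| _)%Z%:R; rewrite !intS; ring.
by move=> i j eq_ij; rewrite -[((i - m) %% _)%Z]modzDml eq_ij modzDml.
Qed.

Lemma sum_emod_clock p :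
  \sum_(i < n) w ^ (i%:Z * p) *: emod F n i%:Z i%:Z = clock_mx p.
Proof.
apply/matrixP=> a b; rewrite summxE mxE.
transitivity (\sum_(i < n) (a.+1%:Z == i%:Z %[mod n%:Z])%Z%:R
    * ((b.+1%:Z == i%:Z %[mod n%:Z])%Z%:R * w ^ (i%:Z * p)) : F).
  by apply: eq_bigr=> i _; rewrite !mxE -mulnb natrM mulrA mulrC.
pose f (i : int) := (b.+1%:Z == i %[mod n%:Z])%Z%:R * w ^ (i * p).
rewrite (sum_residue f) /f => [|i j eq_ij]; last first.
  by rewrite eq_ij (expz_modz _ _ (eqz_modMr i j p eq_ij)).
rewrite mulr_natl eq_sym -eqz_mod_ord !eqz_mod_dvd.
by congr (_ *+ nat_of_bool (_ %| _)%Z); rewrite !intS; ring.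
Qed.

(** * The exchange relation *)

Definition Lblock (l k : int) (x : F) (a c : 'I_2) : 'M[F]_n :=
  if a == c then x *: shift_mx (if a == 0 then l else - l)
  else clock_mx (if a == 0 then 2 * k else - (2 * k)).

Lemma block_Lmat l k x a c : block (Lmat n w l k x) a c = Lblock l k x a c.
Proof.
rewrite /Lmat block_sum.
under eq_bigr => i _ do rewrite blockD blockZ blockD !block_tens !mxE.
move: a c; do 2!elim/ord2_ind; rewrite /Lblock /=.
- under eq_bigr => i _ do rewrite !mulr0 addr0 !scale0r scale1r add0r addr0.
  by rewrite -scaler_sumr sum_emod_shift.
- under eq_bigr => i _ do
    rewrite mulr1 mulr0 addr0 !scale0r !addr0 scaler0 addr0 -mulrA mulrCA.
  exact: sum_emod_clock.
- under eq_bigr => i _ do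
    rewrite mulr1 mulr0 add0r !scale0r !addr0 scaler0 addr0
            -mulrA mulrCA -mulrN.
  exact: sum_emod_clock.
- under eq_bigr => i _ do
    rewrite !mulr0 addr0 !scale0r scale1r !add0r -[l in i%:Z + l]opprK.
  by rewrite -scaler_sumr sum_emod_shift.
Qed.

End Weyl.

(** The six-vertex form of [r]: a nonzero entry keeps the two basis vectors or
    swaps them, which is why each exchange equation has so few terms. *)
Lemma rmatE (F : fieldType) (w : F) l k z a b c d :
  rmat w l k z (mxtens_index (a, b)) (mxtens_index (c, d)) =
  if (a == c) && (b == d) then
    if a == b then w ^ (2 * k * l) * z^-1 - w ^ (- (2 * k * l)) * z
    else z^-1 - z
  else if (a == d) && (b == c) then w ^ (2 * k * l) - w ^ (- (2 * k * l))
  else 0.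
Proof. by rewrite mxE; move: a b c d; do 4!elim/ord2_ind. Qed.

Lemma rmat_Lmat_exchange (F : fieldType) (n : nat) (w : F) (l k : int)
    (x y : F) :
  (0 < n)%N -> w ^+ n = 1 -> x != 0 -> y != 0 ->
  op12 n (rmat w l k (x * y^-1)) *m op13 2 (Lmat n w l k x)
     *m op23 2 (Lmat n w l k y)
  = op23 2 (Lmat n w l k y) *m op13 2 (Lmat n w l k x)
     *m op12 n (rmat w l k (x * y^-1)).
Proof.
move=> n_gt0 wn1 x0 y0; apply: exchange_of_blocks=> a b c d.
have q0 : w ^ (2 * k * l) != 0.
  by rewrite expfz_neq0 // (unity_root_neq0 _ n).
have [e1 e2 e3 e4] : [/\ w ^ (l * (2 * k)) = w ^ (2 * k * l),
    w ^ (l * - (2 * k)) = w ^ (- (2 * k * l)),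
    w ^ (- l * (2 * k)) = w ^ (- (2 * k * l)) &
    w ^ (- l * - (2 * k)) = w ^ (2 * k * l)].
  by split; congr (w ^ _); ring.
move: a b c d; do 4!elim/ord2_ind.
all: rewrite !sum_ord2 !rmatE !block_Lmat // /Lblock /=.
all: rewrite ?scale0r ?addr0 ?add0r.
(* Normal form: a scalar times a clock times a shift. *)
all: rewrite -?scalemxAl -?scalemxAr ?shift_mx_clock_mx //.
all: rewrite ?shift_mxD // ?clock_mxD // ?e1 ?e2 ?e3 ?e4.
all: rewrite ?addrN ?addNr ?shift_mx0 ?clock_mx0 // ?scalerA -?scalerDl //.
all: congr (_ *: _); rewrite -?invr_expz; field.
all: by rewrite ?x0 ?y0 ?q0.
Qed.

Theorem proposition3p1 (R : realType) (n : nat) (w : R[i]) (l k : int)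
    (hn : (2 < n)%N) (hodd : odd n) (hw : n.-primitive_root w)
    (hlk : (l = 0 /\ 1 <= k <= (n.-1)./2%:Z) \/
           (1 <= l <= (n.-1)./2%:Z /\ 0 <= k <= n.-1%:Z))
    (x y : R[i]) (hx : x != 0) (hy : y != 0) :
  op12 n (rmat w l k (x * y^-1)) *m op13 2 (Lmat n w l k x)
     *m op23 2 (Lmat n w l k y)
  = op23 2 (Lmat n w l k y) *m op13 2 (Lmat n w l k x)
     *m op12 n (rmat w l k (x * y^-1)).
Proof.
apply: rmat_Lmat_exchange => //; first exact: ltn_trans hn.
exact: prim_expr_order hw.
Qed.
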